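(* Let $G$ be a finite simple graph with at least one vertex whose minimum degree is at least $2$. Assume that for every vertex $v$ of $G$ of degree $2$ there is a vertex $a$ satisfying: (1) $a\notin N_G[v]$; (2) $N_G(v)\neq N_G(a)$; (3) if $u\in N_G(v)$ has degree $2$, then $a\notin N_G(u)$. Then the dominance complex $\mathcal{D}(G)$ is $1$-connected.
   Context: $N_G(v)$ is the set of neighbors of $v$ and $N_G[v]=N_G(v)\cup\{v\}$. A subset $\sigma\subseteq V(G)$ is dominating if every vertex lies in $\sigma$ or is adjacent to an element of $\sigma$. The dominance complex $\mathcal{D}(G)$ is the simplicial complex on $V(G)$ whose simplices are the subsets of $V(G)$ whose complements are dominating. A space is $1$-connected if it is path-connected (nonempty) and simply connected. *)

(* Defs.v *)
From HB Require Import structures.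
From mathcomp Require Import all_boot all_order all_algebra.
From mathcomp Require Import all_classical all_reals topology normedtype.
From mathcomp Require Import homotopy.

Set Implicit Arguments.
Unset Strict Implicit.
Unset Printing Implicit Defensive.

Import Order.TTheory GRing.Theory Num.Theory.
Import numFieldNormedType.Exports.

Record sgraph (V : finType) := SGraph {
  adj :> rel V;
  adj_sym : symmetric adj;
  adj_irr : irreflexive adj }.

Section Graph.
Variables (V : finType) (G : sgraph V).

Definition nbhd (v : V) : {set V} := [set u | G v u]%SET.
Definition cnbhd (v : V) : {set V} := (v |: nbhd v)%SET.
Definition deg (v : V) : nat := #|nbhd v|.

Definition dominating (s : {set V}) : bool :=
  [forall v, (v \in s) || [exists u in s, G v u]].

End Graph.

(* A singleton {v} need not be a simplex: the ground set V may be larger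
   than the set of actual vertices of the complex. *)
Record scomplex (V : finType) := SComplex {
  simplices :> {set {set V}};
  simplices_closed : forall s t : {set V},
    t \subset s -> s \in simplices -> t \in simplices }.

Section Dominance.
Variables (V : finType) (G : sgraph V).

Definition dominance_simplices : {set {set V}} :=
  [set s : {set V} | dominating G (~: s)]%SET.

Lemma dominance_closed (s t : {set V}) :
  t \subset s -> s \in dominance_simplices -> t \in dominance_simplices.
Proof.
rewrite !inE -finset.setCS => /fintype.subsetP ts /forallP ds; apply/forallP => v.
case/orP: (ds v) => [/ts -> //|/existsP[u /andP[/ts us Gvu]]].
by apply/orP; right; apply/existsP; exists u; rewrite us.
Qed.

Definition dominance_complex : scomplex V := SComplex dominance_closed.

End Dominance.

Local Open Scope classical_set_scope.
Local Open Scope ring_scope.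

(* Barycentric coordinates; as V is finite, the topology induced by the
   pointwise one on V -> R is the usual (weak) topology of the polyhedron. *)
Definition realization_set (R : realType) (V : finType) (K : scomplex V) :
    set {ptws V -> R} :=
  [set x : {ptws V -> R} | [/\ forall v, 0 <= x v,
    \sum_(v : V) x v = 1 & finset (fun v => x v != 0) \in simplices K]].

Definition realization (R : realType) (V : finType) (K : scomplex V) : Type :=
  set_type (@realization_set R V K).

HB.instance Definition _ (R : realType) (V : finType) (K : scomplex V) :=
  Topological.copy (realization R K) (set_type (@realization_set R V K)).

Section UnitInterval.
Variable R : realType.

Definition unit_interval : Type := set_type `[0%R : R, 1%R]%classic.

HB.instance Definition _ :=
  Topological.copy unit_interval (set_type `[0%R : R, 1%R]%classic).

Lemma unit_interval_0 : (0 : R) \in `[0%R : R, 1%R]%classic.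
Proof. by rewrite inE /= in_itv /= lexx ler01. Qed.

Lemma unit_interval_1 : (1 : R) \in `[0%R : R, 1%R]%classic.
Proof. by rewrite inE /= in_itv /= lexx ler01. Qed.

Lemma unit_interval_neq :
  (exist _ 0 unit_interval_0 : unit_interval) !=
  (exist _ 1 unit_interval_1 : unit_interval).
Proof. by apply/eqP => -[] /eqP; rewrite eq_sym oner_eq0. Qed.

HB.instance Definition _ := isBiPointed.Build unit_interval unit_interval_neq.

End UnitInterval.

Section Connectedness.
Variables (R : realType) (T : topologicalType).
Local Notation I := (unit_interval R).

Definition path_connected : Prop :=
  inhabited T /\ forall x y : T, inhabited {path I from x to y}.

Definition path_homotopic (x y : T) (p q : {path I from x to y}) : Prop :=
  exists H : I * I -> T, [/\ continuous H,
    forall t, H (t, zero) = p t, forall t, H (t, one) = q t,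
    forall s, H (zero, s) = x & forall s, H (one, s) = y].

Definition simply_connected : Prop :=
  forall (x : T) (p : {path I from x to x}),
    path_homotopic p (cst x : {path I from x to x}).

Definition one_connected : Prop := path_connected /\ simply_connected.

End Connectedness.

(* Main.v *)
(* Closed neighbourhoods have at least three elements, so the dominance complex K
   has a full 1-skeleton, and a missing triangle is N[v] for some v of degree 2.
   The hypotheses ensure that the vertex a given for v spans a simplex
   with each edge of N[v]: the boundary of every missing triangle is coned off
   inside K.  Mapping each missing triangle onto that cone retracts the union of
   K and all triangles onto K.  So it is enough to contract a loop of |K| through
   triangles: push it along segments to an edge path, as in simplicial
   approximation, and cone the edge path off to a vertex. *)

Require Import Defs.
From mathcomp Require Import all_boot all_order all_algebra.
From mathcomp Require Import all_classical all_reals topology normedtype.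
From mathcomp Require Import homotopy interval_inference lra.

Set Implicit Arguments.
Unset Strict Implicit.
Unset Printing Implicit Defensive.

Import Order.TTheory GRing.Theory Num.Theory.
Import numFieldNormedType.Exports.

Local Open Scope classical_set_scope.
Local Open Scope ring_scope.

(** * Truncation to the unit interval *)

Section Clamp.
Variable R : realType.

(** Truncated parameters make the stages of a homotopy single formulas on the whole line, constant
    before and after their time. *)
Definition clamp (u : R) : R := Num.max 0 (Num.min 1 u).

Lemma clamp_ge0 u : 0 <= clamp u.
Proof. by rewrite le_max lexx. Qed.

Lemma clamp_le1 u : clamp u <= 1.
Proof. by rewrite ge_max ler01 ge_min lexx. Qed.

Lemma clamp_eq0 u : u <= 0 -> clamp u = 0.
Proof. by move=> u0; apply/max_idPl; rewrite ge_min u0 orbT. Qed.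

Lemma clamp_eq1 u : 1 <= u -> clamp u = 1.
Proof. by move=> u1; rewrite /clamp (min_idPl u1); apply/max_idPr/ler01. Qed.

Lemma clamp_id u : 0 <= u <= 1 -> clamp u = u.
Proof. by case/andP=> u0 u1; rewrite /clamp (min_idPr u1); apply/max_idPr. Qed.

Lemma clamp_continuous (T : topologicalType) (f : T -> R) :
  continuous f -> continuous (fun x => clamp (f x)).
Proof.
move=> cf x; apply: (@continuous_max R T (cst 0)); first exact: cvg_cst.
apply: (@continuous_min R T (cst 1)); first exact: cvg_cst.
exact: cf.
Qed.

Lemma affine_continuous (Z : topologicalType) (a b : R) (f : Z -> R) :
  continuous f -> continuous (fun z => a * f z + b).
Proof.
move=> cf z; apply: cvgD; last exact: cvg_cst.
by apply: cvgM; [exact: cvg_cst|exact: cf].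
Qed.

End Clamp.

(** * Coordinatewise continuity *)

Section Realization.
Variables (R : realType) (V : finType).

(** The topology of pointwise convergence is the supremum of those induced by the evaluations. *)
Lemma ptws_continuous (T : topologicalType) (h : T -> {ptws V -> R}) :
  (forall v, continuous (fun z => h z v : R)) -> continuous h.
Proof.
move=> ch z; apply/cvg_sup => v U [/= _ [[W oW <-]] /= Wz] /filterS; apply.
by apply: ch; exact: open_nbhs_nbhs.
Qed.

Lemma ptws_eval_continuous v : continuous (fun x : {ptws V -> R} => x v : R).
Proof. exact: (@proj_continuous V (fun=> R) v). Qed.

End Realization.

(** * Barycentric coordinates and segments *)

Section Simplex.
Variables (R : realType) (V : finType).
Implicit Types (x y : V -> R) (a : R) (v w : V).

Definition supp x : {set V} := [set v | x v != 0]%SET.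

Definition in_simplex x := (forall v, 0 <= x v) /\ \sum_v x v = 1.

Definition mix a x y : V -> R := fun v => (1 - a) * x v + a * y v.

Definition vertex w : V -> R := fun v => (v == w)%:R.

Lemma in_simplex_le1 x v : in_simplex x -> x v <= 1.
Proof.
by case=> x0 <-; rewrite (bigD1 v) //= lerDl sumr_ge0.
Qed.

Lemma in_simplex_supp x : in_simplex x -> exists v, v \in supp x.
Proof.
case=> _ x1; apply/existsP; apply: contraT; rewrite negb_exists => /forallP n.
have := oner_neq0 R; rewrite -x1 big1 ?eqxx // => v _.
by have := n v; rewrite inE negbK => /eqP.
Qed.

Lemma vertex_simplex w : in_simplex (vertex w).
Proof.
split=> [v|]; first exact: ler0n.
rewrite (bigD1 w) //= /vertex eqxx big1 ?addr0 // => v.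
by move/negPf->.
Qed.

Lemma supp_vertex w : supp (vertex w) = [set w]%SET.
Proof. by apply/setP => v; rewrite !inE /vertex pnatr_eq0 eqb0 negbK. Qed.

Lemma mix0 x y : mix 0 x y = x.
Proof. by apply/funext => v; rewrite /mix subr0 mul1r mul0r addr0. Qed.

Lemma mix1 x y : mix 1 x y = y.
Proof. by apply/funext => v; rewrite /mix subrr mul1r mul0r add0r. Qed.

Lemma mixxx a x : mix a x x = x.
Proof. by apply/funext => v; rewrite /mix -mulrDl subrK mul1r. Qed.

Lemma mix_simplex a x y : 0 <= a <= 1 ->
  in_simplex x -> in_simplex y -> in_simplex (mix a x y).
Proof.
case/andP=> a0 a1 [x0 x1] [y0 y1]; split=> [v|].
  by rewrite addr_ge0 // mulr_ge0 // subr_ge0.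
by rewrite big_split /= -!mulr_sumr x1 y1 !mulr1 subrK.
Qed.

Lemma supp_mix a x y (S : {set V}) :
  supp x \subset S -> supp y \subset S -> supp (mix a x y) \subset S.
Proof.
move=> /fintype.subsetP xS /fintype.subsetP yS; apply/fintype.subsetP => v.
rewrite inE => m0; apply: contraT => vS.
have /eqP xv : x v == 0 by apply: contraNT vS => xv; apply: xS; rewrite inE.
have /eqP yv : y v == 0 by apply: contraNT vS => yv; apply: yS; rewrite inE.
by move: m0; rewrite /mix xv yv !mulr0 addr0 eqxx.
Qed.

Lemma mix_continuous (T : topologicalType) (a : T -> R) (x y : T -> V -> R) v :
  continuous a -> continuous (fun t => x t v) -> continuous (fun t => y t v) ->
  continuous (fun t => mix (a t) (x t) (y t) v).
Proof.
move=> ca cx cy t; apply: cvgD; apply: cvgM; do ?[exact: cx|exact: cy|exact: ca].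
by apply: cvgB; [exact: cvg_cst|exact: ca].
Qed.

End Simplex.

(** * Coning off missing triangles *)

Section Coning.
Variables (R : realType) (V : finType) (K : scomplex V) (apex : {set V} -> V).
Implicit Types (S T : {set V}) (x : V -> R).

(** With a full 1-skeleton, the boundary of such a triangle lies in [K] although its interior does
    not. *)
Definition missing T := (#|T| == 3)%N && (T \notin simplices K).

Hypothesis skel1 : forall S, (#|S| <= 2)%N -> S \in simplices K.
Hypothesis coned : forall T w, missing T -> w \in T ->
  (apex T |: T :\ w)%SET \in simplices K.

(** For [x] in the triangle [T], three times this value is the weight of the barycentre when [x] is
    written as a mixture of the barycentre and a boundary point. The default 1 is harmless, since
    coordinates never exceed 1. *)
Definition min_coord T x : R := \big[Num.min/1]_(w in T) x w.

(* On a missing triangle T this is the map onto the cone of its boundary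
   with the apex as the image of the barycentre. *)
Definition cone_off x : V -> R := fun v => x v +
  \sum_(T | missing T) min_coord T x * (3 * vertex R (apex T) v - (v \in T)%:R).

(** For [w = apex T] the set in [coned] would be [T] itself, which is not a simplex. *)
Lemma apexN T : missing T -> apex T \notin T.
Proof.
move=> mT; apply/negP => aT; have := coned mT aT.
by rewrite finset.setD1K // => TK; case/andP: mT => _; rewrite TK.
Qed.

(** Hence a missing triangle with a vertex outside the support of [x] contributes nothing to
    [cone_off x]. *)
Lemma min_coord_eq0 T x w :
  in_simplex x -> w \in T -> w \notin supp x -> min_coord T x = 0.
Proof.
case=> x0 _ wT; rewrite inE negbK => /eqP xw; apply/eqP; rewrite eq_le.
apply/andP; split; last by apply/bigmin_geP; split => [|i _]; rewrite ?ler01.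
by rewrite -xw; exact: bigmin_le_cond.
Qed.

(** No simplex contains a missing triangle, so each missing triangle has a vertex where [x]
    vanishes. *)
Lemma cone_off_id x : in_simplex x -> supp x \in simplices K -> cone_off x = x.
Proof.
move=> sx xK; apply/funext => v; rewrite /cone_off big1 ?addr0 // => T.
case/andP=> _ TK; suff [w wT wx] : exists2 w, w \in T & w \notin supp x.
  by rewrite (min_coord_eq0 sx wT wx) mul0r.
by apply/subsetPn; apply: contra TK => /simplices_closed; exact.
Qed.

(** A support that is not a simplex is a missing triangle [T]. A vertex of [T] with the least
    coordinate loses all its weight to the apex, so the image lies in the simplex that [coned]
    provides. *)
Lemma cone_off_realization x : in_simplex x ->
  supp x \in simplices K \/ (#|supp x| <= 3)%N ->
  realization_set K (cone_off x : {ptws V -> R}).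
Proof.
move=> sx; have [xK _|xK [//|x3]] := boolP (supp x \in simplices K).
  by rewrite cone_off_id //; case: (sx).
set T := supp x in xK x3 *.
have mT : missing T.
  rewrite /missing xK andbT eqn_leq x3 /= ltnNge.
  by apply: contra xK; exact: skel1.
have aT := apexN mT; have T3 : #|T| = 3%N by case/andP: mT => /eqP.
have [w wT minE] : {w | w \in T & min_coord T x = x w}.
  have [w1 w1T] := cid (in_simplex_supp sx).
  have [|u uT uE] := @eq_bigmin _ _ _ 1 w1 (mem T) x w1T.
    by move=> i _; exact: in_simplex_le1.
  by exists u.
have coneE v : cone_off x v =
    x v + x w * (3 * vertex R (apex T) v - (v \in T)%:R).
  (* Any other missing triangle also has three vertices, hence one outside [T]. *)
  rewrite /cone_off (bigD1 T) //= minE big1 ?addr0 // => S /andP[mS ST].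
  suff [u uS uT] : exists2 u, u \in S & u \notin T.
    by rewrite (min_coord_eq0 sx uS uT) mul0r.
  apply/subsetPn; apply: contra ST => ST; rewrite eqEcard ST T3.
  by case/andP: mS => /eqP ->.
have [x0 x1] := sx.
have xT v : v \notin T -> x v = 0 by rewrite inE negbK => /eqP.
split=> [v||].
- rewrite coneE; have [vT|vT] := boolP (v \in T); last first.
    by rewrite subr0 addr_ge0 // !mulr_ge0 // ler0n.
  have /negPf va : v != apex T by apply: contraNneq aT => <-.
  rewrite /vertex va mulr0 sub0r mulrN1 subr_ge0 -minE.
  exact: bigmin_le_cond.
- under eq_bigr do rewrite coneE.
  rewrite big_split -mulr_sumr /= x1 sumrB -mulr_sumr (vertex_simplex _ _).2.
  (* The three vertices of [T] together lose as much weight as the apex gains. *)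
  have -> : \sum_v (v \in T)%:R = 3 :> R.
    rewrite -T3 -sum1_card natr_sum [RHS]big_mkcond.
    by apply: eq_bigr => v _; case: ifP.
  by rewrite mulr1 subrr mulr0 addr0.
- apply: simplices_closed (coned mT wT); apply/fintype.subsetP => v.
  rewrite inE; apply: contraR; rewrite in_setU1 in_setD1 negb_or negb_and negbK.
  rewrite coneE /vertex => /andP[/negPf -> /orP[/eqP->|vT]].
    by rewrite wT mulr0 sub0r mulrN1 subrr.
  by rewrite xT // (negPf vT) mulr0 subr0 mulr0 addr0.
Qed.

Lemma min_coord_continuous (Z : topologicalType) (h : Z -> V -> R) T :
  (forall w, continuous (fun z => h z w)) ->
  continuous (fun z => min_coord T (h z)).
Proof.
move=> ch; apply: (@continuous_big R V) => [|w _]; last exact: ch.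
move=> z; apply: (@continuous_min R _ fst snd); first exact: cvg_fst.
exact: cvg_snd.
Qed.

Lemma cone_off_continuous (Z : topologicalType) (h : Z -> V -> R) v :
  (forall w, continuous (fun z => h z w)) ->
  continuous (fun z => cone_off (h z) v).
Proof.
move=> ch z; apply: cvgD; first exact: ch.
apply: cvg_big => [|T _]; first exact: add_continuous.
apply: cvgM; last exact: cvg_cst.
exact: min_coord_continuous.
Qed.

End Coning.

(** * Approximation of a path by an edge path *)

Section EdgeApproximation.
Variables (R : realType) (V : finType).

(* This is max(0, 1 - |u|), written so that sums of translates telescope. *)
Definition hat (u : R) : R := clamp (u + 1) - clamp u.

Lemma hat_ge0 u : 0 <= hat u.
Proof.
rewrite subr_ge0 ge_max clamp_ge0 /= le_max le_min !ge_min lexx /=.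
by rewrite lerDl ler01 !orbT.
Qed.

Lemma hat_neq0 u : hat u != 0 -> -1 < u < 1.
Proof.
apply: contraR; rewrite negb_and -!leNgt => /orP[u1|u1]; rewrite /hat.
  by rewrite !clamp_eq0 ?subrr //; lra.
by rewrite !clamp_eq1 ?subrr //; lra.
Qed.

Lemma sum_hat n (y : R) : 0 <= y <= n%:R -> \sum_(i < n.+1) hat (y - i%:R) = 1.
Proof.
case/andP=> y0 yn; pose f i : R := - clamp (y - i%:R + 1).
have -> : \sum_(i < n.+1) hat (y - i%:R) = \sum_(0 <= i < n.+1) (f i.+1 - f i).
  rewrite big_mkord; apply: eq_bigr => i _.
  by rewrite /f /hat opprK addrC -natr1 opprD addrA subrK.
(* The first clamp is 1 because [0 <= y], the last is 0 because [y <= n]. *)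
rewrite telescope_sumr // /f subr0 opprK (@clamp_eq1 _ (y + 1)) ?lerDr //.
by rewrite clamp_eq0 ?oppr0 ?add0r // -natr1; lra.
Qed.

Variable p : R -> V -> R.
Hypothesis p_simplex : forall t, in_simplex (p t).
Hypothesis p_continuous : forall v, continuous (fun t => p t v).

(** A Lebesgue number for the cover of [0, 1] by the preimages of the open vertex stars: these are
    open, and compactness makes the radius uniform. *)
Lemma star_lebesgue_number : exists n : nat, forall t, 0 <= t <= 1 ->
  exists v, forall u, `|u - t| < n.+1%:R^-1 -> v \in supp (p u).
Proof.
pose P (n : nat) t :=
  exists v, forall u, `|u - t| < n.+1%:R^-1 -> v \in supp (p u).
suff [n _ /(_ n (leqnn n)) nP] : \forall n \near \oo, `[0, 1]%classic `<=` P n.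
  by exists n => t t01; apply: nP; rewrite /= in_itv.
have /compact_near_coveringP := @segment_compact R 0 1; apply => t _.
have [v] := in_simplex_supp (p_simplex t); rewrite inE => pv.
have : \forall u \near t, p u v != 0.
  by have /cvgr_neq0 := @p_continuous v t; apply.
case/nbhs_ballP => e /= e0 eP.
have e20 : 0 < e / 2 by rewrite divr_gt0.
(* Half of the radius [e] bounds the distance from [s] to [t], the other half that from [u] to
   [s]. *)
near=> s n => /=; exists v => u us; rewrite inE; apply: eP.
rewrite /ball /= (splitr e) -(subrKA s).
apply: le_lt_trans (ler_normD _ _) _; apply: ltrD.
  by near: s; exact: nbhsx_ballx.
rewrite distrC (lt_trans us) //; near: n.
exact: (near_infty_natSinv_lt (PosNum e20)).
Unshelve. all: by end_near. Qed.

(** Divide [0, 1] into [N] equal pieces, choose for each node [i / N] a vertex whose open star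
    contains the image of the open interval of radius [1 / N] around it, and interpolate linearly.
    At each time at most two nodes are active, and their vertices lie in the support of [p t]. *)
Lemma edge_approximation : exists q : R -> V -> R,
  (forall v, continuous (fun t => q t v)) /\
  forall t, 0 <= t <= 1 ->
    [/\ in_simplex (q t), (#|supp (q t)| <= 2)%N & supp (q t) \subset supp (p t)].
Proof.
have [n nP] := star_lebesgue_number; set N : R := n.+1%:R in nP.
have N0 : 0 < N by rewrite ltr0n.
(* Beyond [i = n.+1] the node leaves [0, 1] and any vertex will do. *)
have /choice [w wP] : forall i : nat, exists v, (i <= n.+1)%N ->
    forall u, `|u - i%:R / N| < N^-1 -> v \in supp (p u).
  move=> i; have [iN|iN] := boolP (i <= n.+1)%N; last first.
    by have [v _] := in_simplex_supp (p_simplex 0); exists v.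
  have [|v vP] := nP (i%:R / N); last by exists v.
  by rewrite divr_ge0 ?ler0n //= ler_pdivrMr // mul1r ler_nat.
(* The [n.+1] pieces have [n.+2] end points. *)
pose q t v := \sum_(i < n.+2) hat (N * t - i%:R) * vertex R (w i) v.
have qP t v : v \in supp (q t) ->
    exists i : 'I_n.+2, -1 < N * t - i%:R < 1 /\ v = w i.
  rewrite inE => qv.
  suff [i] : exists i : 'I_n.+2, hat (N * t - i%:R) * vertex R (w i) v != 0.
    rewrite mulf_eq0 negb_or /vertex pnatr_eq0 eqb0 negbK => /andP[/hat_neq0 h].
    by move/eqP; exists i.
  apply/existsP; apply: contraNT qv; rewrite negb_exists => /forallP q0.
  by apply/eqP/big1 => i _; apply/eqP; rewrite -[_ == _]negbK.
exists q; split=> [v t|t t01].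
  apply: cvg_big => [|i _]; first exact: add_continuous.
  apply: cvgM; last exact: cvg_cst.
  have hc : continuous (fun u : R => N * u + - i%:R).
    by apply: affine_continuous => u; exact: cvg_id.
  apply: cvgB; last exact: (clamp_continuous hc).
  apply: (@clamp_continuous R R (fun u => N * u - i%:R + 1)) => u.
  by apply: cvgD; [exact: hc|exact: cvg_cst].
have Nt : 0 <= N * t <= n.+1%:R.
  by case/andP: t01 => t0 t1; rewrite mulr_ge0 ?(ltW N0) //= ler_piMr // ltW.
split.
- split=> [v|]; first by apply: sumr_ge0 => i _; rewrite mulr_ge0 ?hat_ge0 ?ler0n.
  rewrite exchange_big /= -[RHS](sum_hat Nt); apply: eq_bigr => i _.
  by rewrite -mulr_sumr (vertex_simplex _ _).2 mulr1.
(* A hat is nonzero only within distance 1 of its node, which leaves the nodes [k] and [k.+1] around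
   [N * t]. *)
- pose k := Num.trunc (N * t).
  have /andP[Nt0 _] := Nt; have /andP[k1 k2] := truncn_itv Nt0.
  suff /subset_leq_card/leq_trans : supp (q t) \subset [set w k; w k.+1]%SET.
    by apply; rewrite cards2; case: (_ != _).
  apply/fintype.subsetP => v /qP[i [/andP[i1 i2] ->]].
  have ik : (i < k.+2)%N by rewrite -(ltr_nat R) -natr1; lra.
  have ki : (k < i.+1)%N by rewrite -(ltr_nat R) -natr1; lra.
  rewrite !inE; have [->|ik'] := eqVneq (i : nat) k; first by rewrite eqxx.
  suff -> : nat_of_ord i = k.+1 by rewrite eqxx orbT.
  by apply/eqP; rewrite eqn_leq -ltnS ik /= ltn_neqAle eq_sym ik' -ltnS.
- apply/fintype.subsetP => v /qP[i [/andP[i1 i2] ->]].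
  apply: wP; first by rewrite -ltnS.
  have -> : t - i%:R / N = (N * t - i%:R) / N.
    by rewrite mulrBl mulrAC divff ?mul1r // gt_eqF.
  rewrite normrM (gtr0_norm (x := N^-1)) ?invr_gt0 //.
  by rewrite -[ltRHS]mul1r ltr_pM2r ?invr_gt0 // ltr_norml i1.
Qed.

End EdgeApproximation.

(** * Contraction of a loop in coordinates *)

Lemma card_setU1_le3 (V : finType) (S : {set V}) w :
  (#|S| <= 2)%N -> (#|w |: S|%SET <= 3)%N.
Proof. by move=> S2; rewrite cardsU1; case: (_ \notin _) => //; exact: leqW. Qed.

Section Contraction.
Variables (R : realType) (V : finType) (K : scomplex V) (apex : {set V} -> V).
Hypothesis skel1 : forall S : {set V}, (#|S| <= 2)%N -> S \in simplices K.
Hypothesis coned : forall T w, missing K T -> w \in T ->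
  (apex T |: T :\ w)%SET \in simplices K.

Variables (p : R -> V -> R) (x : V -> R).
Hypothesis p_simplex : forall t, in_simplex (p t).
Hypothesis p_supp : forall t, supp (p t) \in simplices K.
Hypothesis p_continuous : forall v, continuous (fun t => p t v).
Hypotheses (p0 : p 0 = x) (p1 : p 1 = x).

(* With c constant near both ends of [0, 1] and e vanishing exactly at the ends,
   the four stages, each lasting a quarter of the time, are: reparametrise p
   into p \o c; push it along segments to the edge path q \o c, except that a
   neighbourhood of the ends is stretched over the segments from x to the ends
   of q; cone q off to the vertex b; retract along the segment from b to x.
   Only the third stage leaves the polyhedron of K, within triangles. *)
Lemma null_homotopy_coordinates : exists h : R * R -> V -> R,
  [/\ forall v, continuous (fun z => h z v),
      forall z, realization_set K (h z : {ptws V -> R}),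
      forall t, h (t, 0) = p t, forall t, h (t, 1) = x &
      forall s, h (0, s) = x /\ h (1, s) = x].
Proof.
have [q [q_continuous qP]] := edge_approximation p_simplex p_continuous.
have sx : in_simplex x by rewrite -p0.
have xK : supp x \in simplices K by rewrite -p0.
have [b bx] := in_simplex_supp sx.
(* [A k] rises from 0 to 1 during the quarter that starts at [k / 4]. [c] moves only in the middle
   third of the loop, and there [e] is 1. *)
pose A k (z : R * R) := clamp (4 * z.2 + - k).
pose c (z : R * R) := clamp (3 * z.1 + -1).
pose e (z : R * R) := clamp (3 * z.1 + 0) * clamp (- 3 * z.1 + 3).
pose h z := mix (e z * A 1 z * (1 - A 3 z))
  (mix (A 2 z) (p ((1 - A 0 z) * z.1 + A 0 z * c z)) x)
  (mix (A 2 z) (q (c z)) (vertex R b)).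
have A01 k z : 0 <= A k z <= 1 by rewrite clamp_ge0 clamp_le1.
have c01 z : 0 <= c z <= 1 by rewrite clamp_ge0 clamp_le1.
have e01 z : 0 <= e z <= 1.
  by rewrite mulr_ge0 ?mulr_ile1 ?clamp_ge0 ?clamp_le1.
have A_continuous k : continuous (A k).
  by apply: clamp_continuous; apply: affine_continuous => z; exact: cvg_snd.
have c_continuous : continuous c.
  by apply: clamp_continuous; apply: affine_continuous => z; exact: cvg_fst.
have e_continuous : continuous e.
  by move=> z; apply: cvgM; apply: (clamp_continuous (affine_continuous _)) => z';
    exact: cvg_fst.
have h_continuous v : continuous (fun z => h z v).
  apply: mix_continuous.
  - move=> z; apply: cvgM.
      by apply: cvgM; [exact: e_continuous|exact: A_continuous].
    by apply: cvgB; [exact: cvg_cst|exact: A_continuous].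
  - apply: mix_continuous => [|z|z]; [exact: A_continuous| |exact: cvg_cst].
    apply: (@continuous_comp _ _ _
      (fun z => (1 - A 0 z) * z.1 + A 0 z * c z) (p ^~ v));
      last exact: p_continuous.
    apply: cvgD; last by apply: cvgM; [exact: A_continuous|exact: c_continuous].
    apply: cvgM; last exact: cvg_fst.
    by apply: cvgB; [exact: cvg_cst|exact: A_continuous].
  - apply: mix_continuous => [|z|z]; [exact: A_continuous| |exact: cvg_cst].
    apply: (@continuous_comp _ _ _ c (q ^~ v)); first exact: c_continuous.
    exact: q_continuous.
have h_simplex z : in_simplex (h z).
  have [qc _ _] := qP _ (c01 z).
  apply: mix_simplex; last 2 first.
  - exact: mix_simplex.
  - by apply: mix_simplex => //; exact: vertex_simplex.
  have /andP[a0 a1] := A01 3 z; have /andP[e0 e1] := e01 z.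
  have /andP[b0 b1] := A01 1 z.
  have eA0 : 0 <= e z * A 1 z by exact: mulr_ge0.
  have eA1 : e z * A 1 z <= 1 by exact: mulr_ile1.
  by apply/andP; split; [apply: mulr_ge0|apply: mulr_ile1] => //; lra.
have h_supp t s : supp (h (t, s)) \in simplices K \/ (#|supp (h (t, s))| <= 3)%N.
  set z := (t, s); have [qc qc2 qcp] := qP _ (c01 z).
  (* In the first half the support lies in that of a point of [p], since the support of [q] lies in
     that of [p] at the same parameter. *)
  have [s12|s12] := leP s (1 / 2).
    left; rewrite /h /A /= (@clamp_eq0 _ (4 * s + - 2)); last lra.
    rewrite (@clamp_eq0 _ (4 * s + - 3)); last lra.
    rewrite !mix0; have [s14|s14] := leP s (1 / 4).
      by rewrite (@clamp_eq0 _ (4 * s + - 1)) ?mulr0 ?mul0r ?mix0 //; lra.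
    rewrite (@clamp_eq1 _ (4 * s + - 0)) ?subrr ?mul0r ?add0r ?mul1r; last lra.
    exact: simplices_closed (supp_mix _ (subxx _) qcp) (p_supp _).
  have [s34|s34] := leP s (3 / 4); last first.
    (* The last quarter stays on the segment between [b] and [x], within the simplex supporting
       [x]. *)
    left; rewrite /h /A /= (@clamp_eq1 _ (4 * s + - 2)); last lra.
    rewrite !mix1; apply: simplices_closed (supp_mix _ (subxx _) _) xK.
    by rewrite supp_vertex finset.sub1set.
  rewrite /h /A /= (@clamp_eq0 _ (4 * s + - 3)) ?(@clamp_eq1 _ (4 * s + - 1));
    try lra.
  rewrite (@clamp_eq1 _ (4 * s + - 0)); last lra.
  rewrite subrr subr0 mul0r add0r mul1r !mulr1.
  have end_supp : c z = 0 \/ c z = 1 -> p (c z) = x by case=> ->.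
  (* In the third quarter either the point is on the segment from [q (c z)] to [b], with at most
     three vertices, or [c z] is an end and everything stays in the support of [x]. *)
  have [e1|cz] : e z = 1 \/ p (c z) = x.
    have [t13|t13] := ltP t (1 / 3).
      by right; apply: end_supp; left; apply: clamp_eq0 => /=; lra.
    have [t23|t23] := leP t (2 / 3); last first.
      by right; apply: end_supp; right; apply: clamp_eq1 => /=; lra.
    by left; rewrite /e !clamp_eq1 ?mulr1 //=; lra.
  - right; rewrite e1 mix1.
    apply: leq_trans (card_setU1_le3 b qc2); apply: subset_leq_card.
    by apply: supp_mix; rewrite ?finset.subsetUr // supp_vertex finset.subsetUl.
  - left; rewrite cz mixxx; rewrite cz in qcp.
    apply: simplices_closed (supp_mix _ (subxx _) (supp_mix _ qcp _)) xK.
    by rewrite supp_vertex finset.sub1set.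
(* The loop and its base point are supported on simplices, so composing with [cone_off] changes no
   boundary value. *)
have cone_p t : cone_off K apex (p t) = p t by exact: cone_off_id.
have cone_x : cone_off K apex x = x by exact: cone_off_id.
exists (fun z => cone_off K apex (h z)); split.
- by move=> v; exact: cone_off_continuous.
- by move=> [t s]; exact: cone_off_realization.
- move=> t; rewrite -[RHS]cone_p; congr cone_off.
  have A0 k : 0 <= k -> A k (t, 0) = 0 by move=> k0; apply: clamp_eq0 => /=; lra.
  by rewrite /h !A0 ?ler0n // mulr0 !mul0r !mix0 subr0 mul1r addr0.
- move=> t; rewrite -[RHS]cone_x; congr cone_off.
  have A1 k : k <= 3 -> A k (t, 1) = 1 by move=> k3; apply: clamp_eq1 => /=; lra.
  by rewrite /h !A1 ?lexx ?ler0n ?ler1n ?ler_nat // subrr mulr0 mix0 mix1.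
- move=> s; split; rewrite -[RHS]cone_x; congr cone_off.
    rewrite /h /e /c /= (@clamp_eq0 _ (3 * 0 + 0)); last lra.
    rewrite (@clamp_eq0 _ (3 * 0 + -1)); last lra.
    by rewrite !mul0r mix0 !mulr0 addr0 p0 mixxx.
  rewrite /h /e /c /= (@clamp_eq0 _ (- 3 * 1 + 3)); last lra.
  rewrite (@clamp_eq1 _ (3 * 1 + -1)); last lra.
  by rewrite mulr0 !mul0r mix0 !mulr1 subrK p1 mixxx.
Qed.

End Contraction.

(** * Paths and homotopies in the realization *)

Section Connectivity.
Variables (R : realType) (V : finType) (K : scomplex V).
Local Notation I := (unit_interval R).
Local Notation X := (realization R K).

Lemma realization_continuous (Z : topologicalType) (f : Z -> X) :
  (forall v, continuous (fun z => set_val (f z) v : R)) -> continuous f.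
Proof.
move=> cf; have : continuous ((set_val : X -> {ptws V -> R}) \o f).
  exact: ptws_continuous.
exact: continuous_comp_initial.
Qed.

Lemma realization_coord_continuous v : continuous (fun x : X => set_val x v : R).
Proof.
move=> x; apply: (@continuous_comp X {ptws V -> R} R set_val (fun y => y v) x).
  exact: initial_continuous.
exact: ptws_eval_continuous.
Qed.

Lemma realizationP (x : X) :
  in_simplex (set_val x) /\ supp (set_val x) \in simplices K.
Proof. by have [? ? ?] := set_mem (svalP x); split; first split. Qed.

Lemma clamp_unit_interval (u : R) : clamp u \in `[0%R : R, 1%R]%classic.
Proof. by rewrite inE /= in_itv /= clamp_ge0 clamp_le1. Qed.

(** A retraction of the line onto [I]; composing with it extends a path to all of [R]. *)
Definition to_unit (u : R) : I := exist _ (clamp u) (clamp_unit_interval u).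

Lemma to_unit_continuous : continuous to_unit.
Proof.
have : continuous ((set_val : I -> R) \o to_unit).
  by apply: clamp_continuous => u; exact: cvg_id.
exact: continuous_comp_initial.
Qed.

Lemma to_unitK (t : I) : to_unit (set_val t) = t.
Proof.
apply: val_inj => /=; apply: clamp_id.
by have := set_mem (svalP t); rewrite /= in_itv.
Qed.

Lemma to_unit0 : to_unit 0 = zero.
Proof. by apply: val_inj => /=; rewrite clamp_eq0. Qed.

Lemma to_unit1 : to_unit 1 = one.
Proof. by apply: val_inj => /=; rewrite clamp_eq1. Qed.

Lemma set_val_unit_continuous : continuous (fun t : I => set_val t : R).
Proof. exact: initial_continuous. Qed.

Lemma path_of_coordinates (x y : X) (f : R -> V -> R) :
    (forall v, continuous (fun t => f t v)) ->
    (forall t, realization_set K (f t : {ptws V -> R})) ->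
    f 0 = set_val x -> f 1 = set_val y ->
  inhabited {path I from x to y}.
Proof.
move=> cf fK f0 f1.
pose g (t : I) : X := exist _ (f (set_val t)) (mem_set (fK (set_val t))).
have cg : continuous g.
  apply: realization_continuous => v t.
  apply: (@continuous_comp _ _ _ _ (fun t => f t v)); last exact: cf.
  exact: set_val_unit_continuous.
have g0 : g zero = x by apply: val_inj.
have g1 : g one = y by apply: val_inj.
by constructor; exact: (mk_path cg g0 g1).
Qed.

(** Three segments suffice: from [x] to a vertex of its support, along a possibly degenerate edge to
    a vertex of the support of [y], then to [y]. *)
Lemma path_connected_of_skel1 : (0 < #|V|)%N ->
  (forall S : {set V}, (#|S| <= 2)%N -> S \in simplices K) ->
  path_connected R X.
Proof.
move=> /card_gt0P[v0 _] skel1; split.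
  have v0K : realization_set K (vertex R v0 : {ptws V -> R}).
    have [? ?] := vertex_simplex R v0; split => //.
    by rewrite -/(supp _) supp_vertex skel1 // cards1.
  by constructor; exact: (exist _ (vertex R v0) (mem_set v0K) : X).
move=> x y; have [sx xK] := realizationP x; have [sy yK] := realizationP y.
have [v vx] := in_simplex_supp sx; have [w wy] := in_simplex_supp sy.
pose A k (t : R) := clamp (3 * t + - k).
pose f t := mix (A 2 t) (mix (A 1 t) (mix (A 0 t) (set_val x) (vertex R v))
  (vertex R w)) (set_val y).
have A01 k t : 0 <= A k t <= 1 by rewrite clamp_ge0 clamp_le1.
apply: (path_of_coordinates (f := f)).
- have cA k : continuous (A k).
    by apply: clamp_continuous; apply: affine_continuous => t; exact: cvg_id.
  have ccst (r : R) : continuous (fun _ : R => r) by move=> t; exact: cvg_cst.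
  by move=> u; apply: mix_continuous => //; apply: mix_continuous => //;
    exact: mix_continuous.
- move=> t; have [f0 f1] : in_simplex (f t).
    apply: mix_simplex => //; apply: mix_simplex => //;
      last exact: vertex_simplex.
    by apply: mix_simplex => //; exact: vertex_simplex.
  split => //; rewrite -/(supp _) /f /A.
  have [t1|t1] := leP t (1 / 3).
    rewrite (@clamp_eq0 _ (3 * t + -2)) ?(@clamp_eq0 _ (3 * t + -1)); try lra.
    rewrite !mix0; apply: simplices_closed (supp_mix _ (subxx _) _) xK.
    by rewrite supp_vertex finset.sub1set.
  rewrite (@clamp_eq1 _ (3 * t + - 0)); last lra.
  rewrite mix1; have [t2|t2] := leP t (2 / 3).
    rewrite (@clamp_eq0 _ (3 * t + -2)); last lra.
    rewrite mix0; apply: (simplices_closed (s := [set v; w]%SET)).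
      by apply: supp_mix; rewrite supp_vertex finset.sub1set !inE eqxx ?orbT.
    by apply: skel1; rewrite cards2; case: (_ != _).
  rewrite (@clamp_eq1 _ (3 * t + - 1)); last lra.
  rewrite mix1; apply: simplices_closed (supp_mix _ _ (subxx _)) yK.
  by rewrite supp_vertex finset.sub1set.
- have A0 k : 0 <= k -> A k 0 = 0 by move=> k0; apply: clamp_eq0 => /=; lra.
  by rewrite /f !A0 ?ler0n // !mix0.
- have A1 k : k <= 2 -> A k 1 = 1 by move=> k3; apply: clamp_eq1 => /=; lra.
  by rewrite /f A1 // mix1.
Qed.

(** The loop, extended to the line, contracts by [null_homotopy_coordinates]; the homotopy is the
    restriction of that contraction to the unit square. *)
Lemma simply_connected_of_cones (apex : {set V} -> V) :
  (forall S : {set V}, (#|S| <= 2)%N -> S \in simplices K) ->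
  (forall T w, missing K T -> w \in T ->
    (apex T |: T :\ w)%SET \in simplices K) ->
  simply_connected R X.
Proof.
move=> skel1 coned x p.
pose P t : V -> R := set_val (p (to_unit t)).
have P_continuous v : continuous (fun t => P t v).
  move=> t; apply: (@continuous_comp _ _ _ to_unit (fun t => set_val (p t) v)).
    exact: to_unit_continuous.
  apply: (@continuous_comp _ _ _ p (fun y : X => set_val y v)).
    exact: cts_fun.
  exact: realization_coord_continuous.
have P_simplex t : in_simplex (P t) by have [] := realizationP (p (to_unit t)).
have P_supp t : supp (P t) \in simplices K.
  by have [] := realizationP (p (to_unit t)).
have P0 : P 0 = set_val x by rewrite /P to_unit0 path_zero.
have P1 : P 1 = set_val x by rewrite /P to_unit1 path_one.
have [h [h_continuous hK h0 h1 hx]] :=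
  null_homotopy_coordinates skel1 coned P_simplex P_supp P_continuous P0 P1.
pose i2 (z : I * I) : R * R := (set_val z.1, set_val z.2).
have i2_continuous : continuous i2.
  move=> z; apply: (@cvg_pair _ _ _ (nbhs z)
    (nbhs (set_val z.1 : R)) (nbhs (set_val z.2 : R))).
    by apply: (continuous_comp cvg_fst); exact: set_val_unit_continuous.
  by apply: (continuous_comp cvg_snd); exact: set_val_unit_continuous.
exists (fun z => exist _ (h (i2 z)) (mem_set (hK (i2 z)))); split.
- apply: realization_continuous => v z.
  apply: (@continuous_comp _ _ _ i2 (fun u => h u v)); first exact: i2_continuous.
  exact: h_continuous.
- by move=> t; apply: val_inj; rewrite /= h0 /P to_unitK.
- by move=> t; apply: val_inj; rewrite /= h1.
- by move=> s; apply: val_inj; rewrite /= (hx _).1.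
- by move=> s; apply: val_inj; rewrite /= (hx _).2.
Qed.

End Connectivity.

Close Scope ring_scope.

(** * Missing triangles of the dominance complex *)

Section DominanceTriangles.
Variables (V : finType) (G : sgraph V).
Local Notation K := (dominance_complex G).

(** The complement of [S] dominates [v] exactly when it meets the closed neighbourhood of [v]. *)
Lemma dominance_simplexE (S : {set V}) :
  (S \in simplices K) = [forall v, ~~ (cnbhd G v \subset S)].
Proof.
rewrite inE; apply: eq_forallb => v; rewrite inE; apply/idP/subsetPn.
  case/orP=> [vS|/existsP[u /andP[uS Gvu]]].
    by exists v; rewrite // !inE eqxx.
  by exists u; rewrite ?inE ?Gvu ?orbT //; move: uS; rewrite inE.
case=> u; rewrite !inE => /orP[/eqP-> ->//|Gvu uS].
by apply/orP; right; apply/existsP; exists u; rewrite inE uS.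
Qed.

Lemma card_cnbhd v : #|cnbhd G v| = (deg G v).+1.
Proof. by rewrite cardsU1 inE adj_irr. Qed.

Hypothesis min_deg : forall v : V, (2 <= deg G v)%N.

Lemma dominance_skel1 (S : {set V}) : (#|S| <= 2)%N -> S \in simplices K.
Proof.
move=> S2; rewrite dominance_simplexE; apply/forallP => v.
apply: contraL (S2) => /subset_leq_card; rewrite card_cnbhd -ltnNge.
by apply: leq_trans; rewrite ltnS.
Qed.

(** A nonsimplex contains a closed neighbourhood, and three elements leave no room for anything
    else. *)
Lemma dominance_nonsimplex3 (S : {set V}) : #|S| = 3%N -> S \notin simplices K ->
  exists2 v, S = cnbhd G v & deg G v = 2%N.
Proof.
move=> S3; rewrite dominance_simplexE => /forallPn[v]; rewrite negbK => vS.
have d2 : deg G v = 2%N.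
  apply/eqP; rewrite eqn_leq min_deg andbT -ltnS -card_cnbhd -S3.
  exact: subset_leq_card.
by exists v => //; apply/esym/eqP; rewrite eqEcard vS S3 card_cnbhd d2.
Qed.

(** Otherwise the set is the closed neighbourhood of one of its elements [x], of degree 2. If
    [x = a], then [w = v] makes the neighbourhoods of [v] and [a] equal, and [w <> v] makes [a]
    adjacent to [v]. If [x = v], then [a] lies in the closed neighbourhood of [v]. If [x] is a
    neighbour of [v], it is adjacent to [a], against the last hypothesis. *)
Lemma dominance_cone v a : deg G v = 2%N ->
  a \notin cnbhd G v -> nbhd G v <> nbhd G a ->
  (forall u : V, u \in nbhd G v -> deg G u = 2%N -> a \notin nbhd G u) ->
  forall w, w \in cnbhd G v -> (a |: cnbhd G v :\ w)%SET \in simplices K.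
Proof.
move=> d2 av nva ua w wv; apply: contraT => nS.
have S3 : #|(a |: cnbhd G v :\ w)%SET| = 3%N.
  rewrite cardsU1 in_setD1 (negPf av) andbF.
  by have := cardsD1 w (cnbhd G v); rewrite wv card_cnbhd d2 => -[->].
have [x Sx dx] := dominance_nonsimplex3 S3 nS.
have xS : x \in (a |: cnbhd G v :\ w)%SET by rewrite Sx setU11.
have aS : a \in cnbhd G x by rewrite -Sx setU11.
move: xS; rewrite in_setU1 in_setD1 in_setU1.
have [xa _|xa /= /andP[xw /orP[/eqP xv|xv]]] := eqVneq x a.
- subst x; case: nva; have [wE|wv'] := eqVneq w v.
    have -> : nbhd G v = (cnbhd G v :\ v)%SET by rewrite setU1K // inE adj_irr.
    have -> : nbhd G a = (cnbhd G a :\ a)%SET by rewrite setU1K // inE adj_irr.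
    by rewrite -Sx wE setU1K // in_setD1 (negPf av) andbF.
  have : v \in cnbhd G a.
    by rewrite -Sx in_setU1 in_setD1 (eq_sym v w) wv' setU11 orbT.
  rewrite !inE => /orP[/eqP va|Gav]; first by rewrite va setU11 in av.
  by move: av; rewrite !inE adj_sym Gav orbT.
- by rewrite xv (negPf av) in aS.
- have := ua x xv dx.
  by move: aS; rewrite in_setU1 eq_sym (negPf xa) /= => ->.
Qed.

End DominanceTriangles.

Theorem theorem5p12 (R : realType) (V : finType) (G : sgraph V)
  (V_nonempty : 0 < #|V|)
  (min_deg : forall v : V, 2 <= deg G v)
  (deg2 : forall v : V, deg G v = 2 ->
    exists a : V,
      [/\ a \notin cnbhd G v,
          nbhd G v <> nbhd G a &
          forall u : V, u \in nbhd G v -> deg G u = 2 -> a \notin nbhd G u]) :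
  one_connected R (realization R (dominance_complex G)).
Proof.
have skel1 := dominance_skel1 min_deg.
split; first exact: path_connected_of_skel1.
have [v0 _] := card_gt0P V_nonempty.
have /choice [apex apexP] : forall T : {set V}, exists a,
    missing (dominance_complex G) T -> forall w, w \in T ->
      (a |: T :\ w)%SET \in simplices (dominance_complex G).
  (* For other sets the apex is irrelevant, and [v0] serves as default. *)
  move=> T; have [/andP[/eqP T3 TK]|_] := boolP (missing _ T); last by exists v0.
  have [v -> d2] := dominance_nonsimplex3 min_deg T3 TK.
  have [a [av nva ua]] := deg2 v d2.
  by exists a => _; exact: dominance_cone.
by apply: simply_connected_of_cones skel1 _ => T w /apexP; apply.
Qed.
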